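(* Let $E$ and $\partial E$ be Banach spaces and let $A_m:D(A_m)\subseteq E\to E$, $B:D(B)\subseteq\partial E\to\partial E$ and $L:D(A_m)\to\partial E$ be linear operators such that (i) $A:=A_m|_{\ker L}$ generates a strongly continuous semigroup on $E$; (ii) $L:D(A_m)\to\partial E$ is surjective; (iii) $\binom{A_m}{L}:D(A_m)\to E\times\partial E$ is closed; (iv) $B$ generates a strongly continuous semigroup on $\partial E$. Let $C\in\mathcal{L}(E,\partial E)$. On $\mathcal{E}=E\times\partial E$ consider $$\mathcal{A}_C=\begin{pmatrix}A_m&0\\C&B\end{pmatrix},\quad \mathcal{A}_0=\begin{pmatrix}A_m&0\\0&B\end{pmatrix},\quad D(\mathcal{A}_C)=D(\mathcal{A}_0)=\bigl\{\tbinom fx\in D(A_m)\times D(B):Lf=x\bigr\},\qquad\mathcal{C}=\begin{pmatrix}0&0\\C&0\end{pmatrix}\in\mathcal{L}(\mathcal{E}),$$ so that $\mathcal{A}_C=\mathcal{A}_0+\mathcal{C}$, and assume that $\mathcal{A}_0$ generates a strongly continuous semigroup $(\mathcal{T}_0(t))_{t\ge0}$ on $\mathcal{E}$. Let $\mathcal{S}(t)=\mathrm{e}^{t\mathcal{C}}$ and let $(\mathcal{T}_C(t))_{t\ge0}$ be the semigroup generated by $\mathcal{A}_C$. Then for all $z\in\mathcal{E}$ and $t\ge0$ $$\mathcal{T}_C(t)z=\lim_{n\to\infty}\bigl(\mathcal{S}(\tfrac tn)\mathcal{T}_0(\tfrac tn)\bigr)^nz,$$ $$\mathcal{T}_C(t)z=\lim_{n\to\infty}\bigl(\mathcal{T}_0(\tfrac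 t{2n})\mathcal{S}(\tfrac tn)\mathcal{T}_0(\tfrac t{2n})\bigr)^nz,$$ $$\mathcal{T}_C(t)z=\lim_{n\to\infty}\frac1{2^n}\bigl(\mathcal{T}_0(\tfrac tn)\mathcal{S}(\tfrac tn)+\mathcal{S}(\tfrac tn)\mathcal{T}_0(\tfrac tn)\bigr)^nz.$$
   Context: $A_m|_{\ker L}$ is the restriction of $A_m$ to the domain $\ker L\subseteq D(A_m)$. Since $\mathcal{C}$ is bounded and $\mathcal{A}_0$ is a generator, $\mathcal{A}_C$ generates a strongly continuous semigroup. Elements of $E\times\partial E$ are written as columns. *)

(* Defs.v *)
From HB Require Import structures.
From mathcomp Require Import all_boot all_order all_algebra.
From mathcomp Require Import all_classical all_reals all_analysis.
From mathcomp Require Import complex.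

Set Implicit Arguments.
Unset Strict Implicit.
Unset Printing Implicit Defensive.

Import Order.TTheory GRing.Theory Num.Theory.
Import numFieldNormedType.Exports.

Local Open Scope classical_set_scope.
Local Open Scope ring_scope.

(* The scalar field is either the reals or the complex numbers.  In both cases
   the times t >= 0 are the t : K with 0 <= t: in the partial order of R[i],
   0 <= t means that t is a nonnegative real number. *)
Definition real_or_complex (R : realType) (K : numFieldType) : Prop :=
  K = R :> numFieldType \/ K = R[i] :> numFieldType.

(* Partially defined operators: the values of app outside dom are irrelevant. *)
Record operator (U V : Type) := Operator { dom : set U ; app :> U -> V }.

Definition op_eq (U V : Type) (A B : operator U V) : Prop :=
  dom A = dom B /\ forall x, dom A x -> A x = B x.

Definition linear_operator (K : numFieldType) (U V : lmodType K)
    (A : operator U V) : Prop :=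
  dom A 0 /\
  forall (a : K) (x y : U), dom A x -> dom A y ->
    dom A (a *: x + y) /\ A (a *: x + y) = a *: A x + A y.

Definition op_restrict (U V : Type) (A : operator U V) (X : set U) :
    operator U V :=
  Operator (dom A `&` X) A.

Definition op_ker (U : Type) (V : nmodType) (A : operator U V) : set U :=
  [set x | dom A x /\ A x = 0].

Definition op_column (U V W : Type) (A : operator U V) (L : operator U W) :
    operator U (V * W) :=
  Operator (dom A `&` dom L) (fun x => (A x, L x)).

Definition op_graph (U V : Type) (A : operator U V) : set (U * V) :=
  [set p | dom A p.1 /\ p.2 = A p.1].

Definition closed_operator (K : numFieldType) (U V : normedModType K)
    (A : operator U V) : Prop :=
  closed (op_graph A : set (U * V)%type).

(* Only the values T t with 0 <= t matter. *)
Definition C0_semigroup (K : numFieldType) (V : normedModType K)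
    (T : K -> V -> V) : Prop :=
  [/\ forall t, 0 <= t -> linear (T t) /\ continuous (T t),
      forall x, T 0 x = x,
      forall s t, 0 <= s -> 0 <= t -> forall x, T (s + t) x = T s (T t x)
    & forall x, {within [set t : K | 0 <= t], continuous (fun t => T t x)}].

Definition generator (K : numFieldType) (V : normedModType K)
    (T : K -> V -> V) : operator V V :=
  Operator [set x | cvg ((fun h => h^-1 *: (T h x - x)) @ 0^'+)]
           (fun x => lim ((fun h => h^-1 *: (T h x - x)) @ 0^'+)).

Definition generates (K : numFieldType) (V : normedModType K)
    (A : operator V V) (T : K -> V -> V) : Prop :=
  C0_semigroup T /\ op_eq A (generator T).

Definition is_generator (K : numFieldType) (V : normedModType K)
    (A : operator V V) : Prop :=
  exists T : K -> V -> V, generates A T.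

Definition exp_op (K : numFieldType) (V : normedModType K) (T : V -> V) :
    V -> V :=
  fun z => limn (series (fun k : nat => (k`!%:R)^-1 *: iter k T z)).

Definition coupled_dom (E F : Type) (Am : operator E E) (B : operator F F)
    (L : operator E F) : set (E * F) :=
  [set z | [/\ dom Am z.1, dom B z.2 & L z.1 = z.2]].

Definition opA_C (K : numFieldType) (E F : lmodType K)
    (Am : operator E E) (B : operator F F) (L : operator E F) (C : E -> F) :
    operator (E * F) (E * F) :=
  Operator (coupled_dom Am B L) (fun z => (Am z.1, C z.1 + B z.2)).

Definition opA_0 (K : numFieldType) (E F : lmodType K)
    (Am : operator E E) (B : operator F F) (L : operator E F) :
    operator (E * F) (E * F) :=
  Operator (coupled_dom Am B L) (fun z => (Am z.1, B z.2)).

Definition calC (K : numFieldType) (E F : lmodType K) (C : E -> F) :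
    E * F -> E * F :=
  fun z => (0, C z.1).

Definition expC (K : numFieldType) (E F : normedModType K) (C : E -> F)
    (t : K) : E * F -> E * F :=
  exp_op (fun z : E * F => t *: (calC C z : E * F)).

(* Main.v *)
Require Import Defs.
From HB Require Import structures.
From mathcomp Require Import all_boot all_order all_algebra.
From mathcomp Require Import all_classical all_reals all_analysis.
From mathcomp Require Import ring complex.

(** Since the off-diagonal operator squares to zero, its exponential is exactly
    1 + tC (write C also for the bounded operator on the product space), and
    each of the three product formulas is a one-step scheme of the shape
    W(h) = T0(h) + h Q(h), where Q(h) is bounded uniformly for small h and
    converges strongly to C as h decreases to 0:

      Lie        Q(h) = C T0(h),
      Strang     Q(h) = T0(h/2) C T0(h/2),
      weighted   Q(h) = (T0(h) C + C T0(h)) / 2.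

    The theorem is then the Lax principle: stability and consistency give
    convergence.

    Stability [scheme_stable].  If M bounds T0 on [0, t] and c bounds Q there,
    then T0(s) W(h)^k is bounded by M (1 + hMc)^k as long as s + kh <= t.  Keeping
    the factor T0(s) in front makes this an induction on k without any
    renorming.

    Consistency [difference_cvg].  The claim is that (TC(h) x - T0(h) x) / h
    tends to C x for every x, not only for x in the domain.  On the domain this
    is the definition of the generators, whose difference is C.  It extends to
    all x as soon as TC(h) - T0(h) is bounded by k h [difference_bound] and the
    domain is dense [generator_dense].  The first fact is the usual Duhamel
    estimate, obtained here without an integral: for x in the domain the path
    s |-> T0(h - s) TC(s) x has right derivative T0(h - s) C TC(s) x, so a
    mean value inequality for right difference quotients bounds the distance
    between its end points.  The second fact uses only dyadic Riemann sums of
    the orbit.  As the difference quotients are uniformly bounded, their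
    convergence is uniform on the compact orbit segments TC([0, t]) z
    [scheme_consistent], and a telescoping sum [scheme_error] concludes.

    Everything above takes place over the reals.  The scalar field of the
    theorem is the reals or the complex numbers; in either case the space,
    its semigroups and their generators are restricted to real scalars and
    real times, which changes neither the topology nor the limits involved. *)

Set Implicit Arguments.
Unset Strict Implicit.
Unset Printing Implicit Defensive.

Import Order.TTheory GRing.Theory Num.Theory.
Import numFieldNormedType.Exports.

Local Open Scope classical_set_scope.
Local Open Scope ring_scope.

(** * Tools from analysis *)

Section Analysis.
Variables (R : realType) (V : normedModType R).

(** Strong convergence of uniformly Lipschitz maps also holds along convergent
    arguments; this is how pointwise limits become joint limits below. *)
Lemma cvg_equilipschitz (W : normedModType R) (I : Type) (F : set_system I)
    {FF : Filter F} (B : I -> V -> W) (M : R) (x : I -> V) (x0 : V) (l : W) :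
  0 <= M ->
  (\forall i \near F, forall y z, `|B i y - B i z| <= M * `|y - z|) ->
  (fun i => B i x0) @ F --> l -> x @ F --> x0 -> (fun i => B i (x i)) @ F --> l.
Proof.
move=> M0 BM Bl xx0; apply/cvgrPdist_lt => e e0.
have e20 : 0 < e / 2 by rewrite divr_gt0.
have e2M : 0 < e / 2 / (M + 1) by rewrite divr_gt0 // ltr_wpDl.
near=> i.
have h1 : `|l - B i x0| < e / 2 by near: i; exact: cvgr_dist_lt.
have h2 : `|x0 - x i| < e / 2 / (M + 1) by near: i; exact: cvgr_dist_lt.
have BMi : forall y z, `|B i y - B i z| <= M * `|y - z| by near: i.
have h3 : `|B i x0 - B i (x i)| <= M * `|x0 - x i| by [].
rewrite -(subrK (B i x0) l) -addrA (le_lt_trans (ler_normD _ _)) //.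
rewrite [ltRHS](splitr e); apply: ltr_leD => //; apply: le_trans h3 _.
rewrite (@le_trans _ _ ((M + 1) * `|x0 - x i|)) ?ler_wpM2r ?lerDl //.
by rewrite mulrC -ler_pdivlMr ?ltW // ltr_wpDl.
Unshelve. all: by end_near. Qed.

Lemma continuous_linear_norm_bound (W : normedModType R) (f : V -> W) :
  linear f -> continuous f -> exists2 c, 0 <= c & forall x, `|f x| <= c * `|x|.
Proof.
move=> lf cf.
pose g : {linear V -> W} := HB.pack f (GRing.isLinear.Build _ _ _ _ _ lf).
have /linear_boundedP/pinfty_ex_gt0[c c0 cP] : bounded_near g (nbhs 0).
  by apply/linear_bounded_continuous.
by exists c; [exact: ltW|].
Qed.

(** By continuity, the set of those s in [a, b] at which the estimate from a holds
    with k + e contains its supremum; the supremum cannot be less than b, since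
    the quotient bound carries the estimate a little further to the right. *)
Lemma right_lipschitz_bound (f : R -> V) (a b k : R) : a <= b ->
  {within `[a, b], continuous f} ->
  (forall s, a <= s < b -> forall e, 0 < e ->
     \forall d \near 0^'+, `|f (s + d) - f s| <= (k + e) * d) ->
  `|f b - f a| <= k * (b - a).
Proof.
move=> ab fc fr.
suff H e : 0 < e -> `|f b - f a| <= (k + e) * (b - a).
  apply/ler_addgt0Pr => e e0.
  have ba0 : 0 < b - a + 1 by rewrite ltr_wpDl // subr_ge0.
  have := H (e / (b - a + 1)) (divr_gt0 e0 ba0); move/le_trans; apply.
  rewrite mulrDl lerD2l -mulrA ler_piMr ?(ltW e0) // mulrC ler_pdivrMr //.
  by rewrite mul1r lerDl.
move=> e0.
pose A := [set s | a <= s <= b /\ `|f s - f a| <= (k + e) * (s - a)].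
have Aa : A a by split; rewrite ?lexx // !subrr normr0 mulr0.
have supA : has_sup A by split; [exists a|exists b => s [/andP[]]].
pose m := sup A.
have am : a <= m by exact: sup_upper_bound.
have mb : m <= b by apply: ge_sup; [exists a|move=> s [/andP[]]].
have Am : A m.
  split; first by rewrite am.
  rewrite leNgt; apply/negP => lt_m.
  pose g s := `|f s - f a| - (k + e) * (s - a).
  have gc : g @ within `[a, b]%classic (nbhs m) --> g m.
    have fm : f @ within `[a, b]%classic (nbhs m) --> f m.
      by move/subspace_continuousP : fc; apply; rewrite /= in_itv /= am.
    apply: cvgB; first by apply: cvg_norm; apply: cvgB => //; exact: cvg_cst.
    apply: cvgMl_tmp; apply: cvgB; last exact: cvg_cst.
    exact: cvg_within.
  have : \forall s \near within `[a, b]%classic (nbhs m), 0 < g s.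
    by apply: (cvgr_gt (g m)) gc _ _; rewrite subr_gt0.
  rewrite /within /= => /nbhs_ballP[d /= d0 dP].
  have [s As ms] := sup_adherent d0 supA.
  have sm : s <= m by exact: sup_upper_bound.
  case: As => sab; have := dP s; rewrite /ball /= ger0_norm ?subr_ge0 //.
  rewrite ltrBlDr -ltrBlDl in_itv /= sab ms subr_gt0 => /(_ isT isT).
  by rewrite ltNge => /negP.
have [<-|mneb] := eqVneq m b; first by case: Am.
have ltmb : m < b by rewrite lt_neqAle mneb.
have [d [d0 dmb fd]] : exists d, [/\ 0 < d, m + d <= b &
     `|f (m + d) - f m| <= (k + e) * d].
  near (0 : R)^'+ => d; exists d; split => //.
    rewrite -lerBrDl; near: d; apply: nbhs_right_le; by rewrite subr_gt0.
  by near: d; apply: fr => //; rewrite am.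
suff /(sup_upper_bound supA) : A (m + d) by rewrite gerDl leNgt d0.
split; first by rewrite dmb (le_trans am) // lerDl ltW.
rewrite -(subrK (f m) (f (m + d))) -addrA (le_trans (ler_normD _ _)) //.
rewrite [leRHS](_ : _ = (k + e) * d + (k + e) * (m - a)); last first.
  by rewrite -mulrDr addrCA addrA.
by apply: lerD => //; case: Am.
Unshelve. all: by end_near. Qed.

Lemma div_nat_cvg_right (t : R) : 0 < t -> t / n%:R @[n --> \oo] --> (0 : R)^'+.
Proof.
move=> t0 A /nbhs_ballP[d /= d0 dA].
change (\forall n \near \oo, A (t / n%:R)); near=> n.
have n0 : 0 < n%:R :> R by near: n; exact: nbhs_infty_gtr.
have tn : 0 < t / n%:R by rewrite divr_gt0.
apply: dA => //; rewrite /ball /= sub0r normrN gtr0_norm //.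
rewrite ltr_pdivrMr // mulrC -ltr_pdivrMr //.
by near: n; exact: nbhs_infty_gtr.
Unshelve. all: by end_near. Qed.

End Analysis.

(** * Strongly continuous semigroups: bounds and joint continuity *)

Section Semigroup.
Variables (R : realType) (V : completeNormedModType R).
Implicit Types (T : R -> V -> V).

Lemma semigroup_additive T s : C0_semigroup T -> 0 <= s ->
  forall x y, T s (x - y) = T s x - T s y.
Proof.
case=> /(_ s) Tl _ _ _ s0 x y; have [{}Tl _] := Tl s0.
by have := Tl (-1) y x; rewrite !scaleN1r ![- _ + _]addrC.
Qed.

Lemma semigroup_scale T s : C0_semigroup T -> 0 <= s ->
  forall a x, T s (a *: x) = a *: T s x.
Proof.
move=> TC s0 a x; have T0 : T s 0 = 0.
  by have := semigroup_additive TC s0 0 0; rewrite !subrr.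
case: TC => /(_ s s0)[Tl _] _ _ _.
by have := Tl a x 0; rewrite !addr0 T0 addr0.
Qed.

Lemma semigroup_orbit_cvg T : C0_semigroup T ->
  forall (I : Type) (F : set_system I) {FF : Filter F} (s : I -> R) (s0 : R) (x : V),
  0 <= s0 -> (\forall i \near F, 0 <= s i) -> s @ F --> s0 ->
  (fun i => T (s i) x) @ F --> T s0 x.
Proof.
case=> _ _ _ Tc I F FF s s0 x s00 sge0 scvg.
have /subspace_continuousP /(_ s0 s00) h := Tc x.
apply: (@cvg_comp _ _ _ s (fun t => T t x) F _ _ _ h).
move=> A; rewrite /within/= !nbhs_simpl /= => nA.
have : \forall i \near F, 0 <= s i -> A (s i) by exact: (scvg _ nA).
by apply: filterS2 sge0 => i /[swap]; apply.
Qed.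

(** Orbits are continuous, hence bounded on compact intervals, and the
    uniform boundedness principle applies. *)
Lemma semigroup_bounded T (b : R) : C0_semigroup T ->
  exists2 M, 0 <= M & forall s x, 0 <= s <= b -> `|T s x| <= M * `|x|.
Proof.
move=> TC.
pose F := [set T s | s in `[0, b]%classic].
have bF : forall f, F f -> bounded_fun_norm f /\ linear f.
  move=> _ [s /= + <-]; rewrite in_itv /= => /andP[s0 _].
  case: (TC) => /(_ s s0)[Tl Tcont] _ _ _; split => //.
  have [c c0 cP] := continuous_linear_norm_bound Tl Tcont.
  by move=> r; exists (c * r) => x xr; apply: le_trans (cP x) _; exact: ler_wpM2l.
have pF : pointwise_bounded F.
  move=> x.
  have Kc : {within `[0, b], continuous (fun s => T s x)}.
    case: TC => _ _ _ /(_ x) Tc; apply: continuous_subspaceW Tc => s /=.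
    by rewrite in_itv /= => /andP[].
  have [M [_ MP]] := compact_bounded (continuous_compact Kc (@segment_compact _ 0 b)).
  exists (M + 1) => _ [s sb <-]; apply: MP; first by rewrite ltrDl.
  by exists s.
have [M MP] := Banach_Steinhauss bF pF 1.
exists (Num.max M 0) => [|s x sb]; first by rewrite le_max lexx orbT.
have [->|x0] := eqVneq x 0.
  rewrite -(subrr 0) semigroup_additive ?subrr ?normr0 ?mulr0 //.
  by case/andP: sb.
have nx : 0 < `|x| by rewrite normr_gt0.
have s0 : 0 <= s by case/andP: sb.
have FTs : F (T s) by exists s => //=; rewrite in_itv.
have nx1 : `|(`|x|^-1 *: x)| <= 1 by rewrite normrZ normfV normr_id mulVf ?gt_eqF.
have := MP (T s) FTs _ nx1.
rewrite semigroup_scale // normrZ normfV normr_id ler_pdivrMl // => /le_trans.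
by apply; rewrite mulrC ler_wpM2r // le_max lexx.
Qed.

(** Local boundedness upgrades strong continuity to joint continuity.  The filter
    is arbitrary so as to cover limits in h, in n, and in pairs (s, n). *)
Lemma semigroup_cvg T : C0_semigroup T ->
  forall (I : Type) (F : set_system I) {FF : Filter F} (s : I -> R) (x : I -> V) (s0 : R) (x0 : V),
  0 <= s0 -> (\forall i \near F, 0 <= s i) -> s @ F --> s0 -> x @ F --> x0 ->
  (fun i => T (s i) (x i)) @ F --> T s0 x0.
Proof.
move=> TC I F FF s x s0 x0 s00 sge0 scvg xcvg.
have [M M0 MP] := semigroup_bounded (s0 + 1) TC.
apply: (@cvg_equilipschitz _ _ _ _ F _ (fun i => T (s i)) M x x0) => //.
  near=> i => y z.
  have si0 : 0 <= s i by near: i.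
  rewrite -(semigroup_additive TC) //; apply: MP; rewrite si0 /=.
  by near: i; apply: (cvgr_le s0); rewrite // ltrDl.
exact: semigroup_orbit_cvg.
Unshelve. all: by end_near. Qed.
End Semigroup.

(** * The generator and the density of its domain *)

Section Generator.
Variables (R : realType) (V : completeNormedModType R) (T : R -> V -> V).
Hypothesis T_semigroup : C0_semigroup T.

Lemma generator_cvg x : dom (generator T) x ->
  (fun h => h^-1 *: (T h x - x)) @ 0^'+ --> generator T x.
Proof. by []. Qed.

Lemma cvg_generator x l : (fun h => h^-1 *: (T h x - x)) @ 0^'+ --> l ->
  dom (generator T) x /\ generator T x = l.
Proof.
move=> cl; split; first by apply/cvg_ex; exists l.
exact: (cvg_lim (@norm_hausdorff _ _) cl).
Qed.

(** T(s) commutes with the difference quotients defining the generator. *)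
Lemma generator_dom_semigroup s x : 0 <= s -> dom (generator T) x ->
  dom (generator T) (T s x).
Proof.
move=> s0 /generator_cvg Dx; suff [] : dom (generator T) (T s x) /\
  generator T (T s x) = T s (generator T x) by [].
apply: cvg_generator.
have TDx : T s (h^-1 *: (T h x - x)) @[h --> 0^'+] --> T s (generator T x).
  by apply: semigroup_cvg Dx => //; [exact: nearW|exact: cvg_cst].
apply: cvg_trans TDx; apply: near_eq_cvg; near=> h.
have h0 : 0 <= h by near: h; exact: nbhs_right_ge.
rewrite semigroup_scale // semigroup_additive //; congr (_ *: (_ - _)).
by case: T_semigroup => _ _ Tadd _; rewrite -!Tadd // addrC.
Unshelve. all: by end_near. Qed.

Definition orbit_sum (n : nat) (d : R) (x : V) := \sum_(k < n) T (k%:R * d) x.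

(** A Riemann sum, divided by the length of the interval, of the orbit of x on
    [0, nd]; its limit replaces the mean of the orbit. *)
Definition orbit_mean n d x := n%:R^-1 *: orbit_sum n d x.

Lemma semigroup_add s : 0 <= s -> {morph T s : x y / x + y}.
Proof.
move=> s0 x y; case: T_semigroup => /(_ s s0)[Tl _] _ _ _.
by have := Tl 1 x y; rewrite !scale1r.
Qed.

Lemma semigroup0 s : 0 <= s -> T s 0 = 0.
Proof.
by move=> s0; have := semigroup_scale T_semigroup s0 0 0; rewrite !scale0r.
Qed.

Lemma orbit_sumD n p d x : 0 <= d ->
  orbit_sum (n + p) d x = orbit_sum n d x + T (n%:R * d) (orbit_sum p d x).
Proof.
move=> d0; have nd0 : 0 <= n%:R * d by rewrite mulr_ge0.
rewrite /orbit_sum big_split_ord /= (big_morph _ (semigroup_add nd0) (id1 := 0)).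
  congr (_ + _); apply: eq_bigr => i _; case: T_semigroup => _ _ Tadd _.
  by rewrite -Tadd ?mulr_ge0 // natrD mulrDl.
by rewrite semigroup0.
Qed.

(** Refining a grid replaces each term by a shifted sum over a finer grid; this
    compares Riemann sums at different levels. *)
Lemma orbit_sumM q p d x : 0 <= d ->
  orbit_sum (q * p) d x = orbit_sum q (p%:R * d) (orbit_sum p d x).
Proof.
move=> d0; elim: q => [|q IHq]; first by rewrite mul0n /orbit_sum !big_ord0.
rewrite mulSnr orbit_sumD // IHq -addn1 orbit_sumD ?mulr_ge0 //.
congr (_ + _); rewrite natrM mulrA; congr (T _ _).
rewrite /orbit_sum big_ord1 mul0r.
by case: T_semigroup => _ T0 _ _; rewrite T0.
Qed.

Lemma orbit_sum_scale n d a x : 0 <= d ->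
  orbit_sum n d (a *: x) = a *: orbit_sum n d x.
Proof.
move=> d0; rewrite /orbit_sum scaler_sumr; apply: eq_bigr => i _.
by rewrite semigroup_scale // mulr_ge0.
Qed.

Lemma orbit_sumB n d x y : 0 <= d ->
  orbit_sum n d (x - y) = orbit_sum n d x - orbit_sum n d y.
Proof.
move=> d0; rewrite /orbit_sum -sumrB; apply: eq_bigr => i _.
by rewrite semigroup_additive // mulr_ge0.
Qed.

Lemma orbit_meanM q p d x : 0 <= d ->
  orbit_mean (q * p) d x = orbit_mean q (p%:R * d) (orbit_mean p d x).
Proof.
move=> d0; rewrite /orbit_mean orbit_sumM // orbit_sum_scale ?mulr_ge0 //.
by rewrite scalerA natrM invfM.
Qed.

Lemma orbit_mean_bound n d x e : (0 < n)%N ->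
  (forall k, (k < n)%N -> `|T (k%:R * d) x| <= e) -> `|orbit_mean n d x| <= e.
Proof.
move=> n0 H; rewrite /orbit_mean normrZ ger0_norm ?invr_ge0 //.
rewrite ler_pdivrMl ?ltr0n // (le_trans (ler_norm_sum _ _ _)) //.
rewrite (le_trans (ler_sum _ (G := fun=> e) _)) => [|i _|]; first by [].
  exact: H.
by rewrite sumr_const card_ord mulr_natl.
Qed.

Lemma orbit_mean_dist n d x e : (0 < n)%N ->
  (forall k, (k < n)%N -> `|T (k%:R * d) x - x| <= e) ->
  `|orbit_mean n d x - x| <= e.
Proof.
move=> n0 H.
have -> : orbit_mean n d x - x = n%:R^-1 *: \sum_(k < n) (T (k%:R * d) x - x).
  rewrite sumrB sumr_const card_ord scalerBr -[x *+ n]scaler_nat scalerA mulVf ?scale1r //.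
  by rewrite pnatr_eq0 -lt0n.
rewrite normrZ ger0_norm ?invr_ge0 //.
rewrite ler_pdivrMl ?ltr0n // (le_trans (ler_norm_sum _ _ _)) //.
rewrite (le_trans (ler_sum _ (G := fun=> e) _)) => [|i _|]; first by [].
  exact: H.
by rewrite sumr_const card_ord mulr_natl.
Qed.

(** Up to the factor 1 / n both sides are the sum over [0, (n + p) d] minus two overlapping sums: the
    discrete form of the identity that T(s) - 1 applied to the integral of the
    orbit over [0, h] is T(h) - 1 applied to the integral over [0, s]. *)
Lemma orbit_mean_shift p n d x : 0 <= d ->
  T (p%:R * d) (orbit_mean n d x) - orbit_mean n d x =
  (p%:R / n%:R) *: (T (n%:R * d) (orbit_mean p d x) - orbit_mean p d x).
Proof.
move=> d0; have pd : 0 <= p%:R * d by rewrite mulr_ge0.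
have nd : 0 <= n%:R * d by rewrite mulr_ge0.
rewrite /orbit_mean !semigroup_scale // -!scalerBr scalerA.
have -> : T (p%:R * d) (orbit_sum n d x) - orbit_sum n d x =
          T (n%:R * d) (orbit_sum p d x) - orbit_sum p d x.
  have := orbit_sumD n p x d0; rewrite addnC orbit_sumD // => E.
  apply/eqP; rewrite subr_eq addrAC [_ + orbit_sum n d x]addrC -E.
  by rewrite addrAC subrr add0r.
case: p {pd} => [|p]; last by rewrite mulrAC mulfV ?pnatr_eq0 // mul1r.
by rewrite /orbit_sum big_ord0 semigroup0 // subr0 !scaler0.
Qed.

Lemma orbit_near0 (x : V) (e : R) : 0 < e ->
  exists2 d, 0 < d & forall r, 0 <= r <= d -> `|T r x - x| <= e.
Proof.
move=> e0; case: T_semigroup => _ Tid _ /(_ x)/subspace_continuousP/(_ 0 (lexx _)).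
rewrite /from_subspace => /cvgrPdist_le/(_ e e0); rewrite Tid => /nbhs_ballP[d /= d0 dP].
exists (d / 2); first by rewrite divr_gt0.
move=> r /andP[r0 rd]; rewrite distrC; apply: (dP r) => //.
rewrite /ball /= sub0r normrN ger0_norm //; apply: le_lt_trans rd _.
by rewrite ltr_pdivrMr // ltr_pMr // ltr1n.
Qed.

(** The means at level m are obtained from those at level N by replacing x with
    its own mean over a cell of length h / 2^N, which is close to x; the means
    thus form a Cauchy sequence. *)
Lemma dyadic_means_cvg (h : R) (x : V) : 0 <= h ->
  cvgn (fun n => orbit_mean (2 ^ n) (h / (2 ^ n)%:R) x).
Proof.
move=> h0; have [M M0 MP] := semigroup_bounded h T_semigroup.
apply/cauchy_cvgP/cauchy_exP => e e0.
have M1 : 0 < M + 1 by rewrite ltr_wpDl.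
have [d d0 dP] := orbit_near0 x (divr_gt0 e0 M1).
have pow_gt0 k : 0 < (2 ^ k)%:R :> R by rewrite ltr0n expn_gt0.
(* 2^N > N >= h / d makes the cells shorter than d. *)
pose N := (Num.truncn (h / d)).+1.
have hN : h / (2 ^ N)%:R <= d.
  rewrite ler_pdivrMr // mulrC -ler_pdivrMr // ltW //.
  by apply: lt_le_trans (truncnS_gt _) _; rewrite ler_nat ltnW // ltn_expl.
exists (orbit_mean (2 ^ N) (h / (2 ^ N)%:R) x).
exists N => //= m /= Nm.
rewrite -ball_normE /ball_ /= distrC.
have hm : 0 <= h / (2 ^ m)%:R by rewrite divr_ge0.
have hNm : (2 ^ (m - N))%:R * (h / (2 ^ m)%:R) = h / (2 ^ N)%:R.
  rewrite -[X in (2 ^ X)%:R^-1](subnK Nm) expnD natrM invfM mulrCA !mulrA.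
  by rewrite mulfK // gt_eqF.
rewrite -[X in orbit_mean (2 ^ X)](subnKC Nm) expnD orbit_meanM // hNm.
rewrite /orbit_mean -scalerBr -orbit_sumB ?divr_ge0 // -/(orbit_mean _ _ _).
have small : `|orbit_mean (2 ^ (m - N)) (h / (2 ^ m)%:R) x - x| <= e / (M + 1).
  apply: orbit_mean_dist; first by rewrite expn_gt0.
  move=> k km; apply: dP; rewrite mulr_ge0 //=; apply: le_trans hN.
  by rewrite -hNm ler_wpM2r // ler_nat ltnW.
apply: (@le_lt_trans _ _ (M * (e / (M + 1)))); last first.
  by rewrite mulrCA gtr_pMr // ltr_pdivrMr // mul1r ltrDl.
apply: orbit_mean_bound; first by rewrite expn_gt0.
move=> k kN; apply: (le_trans (MP _ _ _)); last exact: ler_wpM2l.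
rewrite mulr_ge0 ?divr_ge0 //= mulrA ler_pdivrMr // mulrC ler_wpM2l //.
by rewrite ler_nat ltnW.
Qed.

Lemma truncated_dyadic_cvg (u : R) : 0 <= u ->
  (Num.truncn (u * (2 ^ n)%:R))%:R / (2 ^ n)%:R @[n --> \oo] --> u.
Proof.
move=> u0; have pow_gt0 k : 0 < (2 ^ k)%:R :> R by rewrite ltr0n expn_gt0.
apply: (squeeze_cvgr (f := fun n => u - harmonic n) (h := fun=> u)); last 2 first.
- rewrite -[X in _ --> X]subr0; apply: cvgB; first exact: cvg_cst.
  exact: cvg_harmonic.
- exact: cvg_cst.
apply: nearW => n; rewrite ler_pdivrMr // truncn_le ?mulr_ge0 // andbT.
rewrite ler_pdivlMr // mulrBl lerBlDr.
apply: le_trans (ltW (truncnS_gt _)) _; rewrite -natr1 lerD2l.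
by rewrite mulrC ler_pdivlMr // mul1r ler_nat ltn_expl.
Qed.

(** The limit y of the dyadic means over [0, h] is within e of x when h is
    small.  It lies in the domain, with image (T(h) x - x) / h, because the
    shift identity for the approximating means passes to the limit along the
    dyadic approximations of s. *)
Lemma generator_dense (x : V) (e : R) : 0 < e ->
  exists2 y, dom (generator T) y & `|y - x| <= e.
Proof.
move=> e0; have [h h0 hP] := orbit_near0 x e0.
have pow_gt0 k : 0 < (2 ^ k)%:R :> R by rewrite ltr0n expn_gt0.
have [M M0 MP] := semigroup_bounded h T_semigroup.
pose u n := orbit_mean (2 ^ n) (h / (2 ^ n)%:R) x.
have uy : u @ \oo --> limn u by exact: dyadic_means_cvg (ltW h0).
set y := limn u in uy.
exists y; last first.
  have : `|u n - x| @[n --> \oo] --> `|y - x|.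
    by apply: cvg_norm; apply: cvgB => //; exact: cvg_cst.
  move=> /ler_cvg_to; apply; first exact: (cvg_cst e).
  apply: nearW => n; apply: orbit_mean_dist; first by rewrite expn_gt0.
  move=> k kn; apply: hP; rewrite mulr_ge0 ?divr_ge0 ?(ltW h0) //=.
  by rewrite mulrA ler_pdivrMr // mulrC ler_wpM2l ?(ltW h0) // ler_nat ltnW.
(* After division by s this gives the derivative of the orbit of y at 0, since d
   can be taken small with s. *)
have step s d : 0 <= s -> (forall r, 0 <= r <= s -> `|T r x - x| <= d) ->
  `|T s y - y - (s / h) *: (T h x - x)| <= (s / h) * ((M + 1) * d).
  move=> s0 sd.
  (* p n steps of length h / 2^n approximate s from below. *)
  pose p n := Num.truncn (s / h * (2 ^ n)%:R).
  have pcvg : (p n)%:R / (2 ^ n)%:R @[n --> \oo] --> s / h.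
    by apply: truncated_dyadic_cvg; rewrite divr_ge0 // ltW.
  pose t n := (p n)%:R * (h / (2 ^ n)%:R).
  have tcvg : t @ \oo --> s.
    rewrite (_ : t = fun n => (p n)%:R / (2 ^ n)%:R * h); last first.
      by apply/funext => n; rewrite /t mulrA mulrAC.
    by rewrite -[X in _ --> X](divfK (lt0r_neq0 h0)); exact: cvgMr_tmp.
  have lhs : `|T (t n) (u n) - u n - ((p n)%:R / (2 ^ n)%:R) *: (T h x - x)|
    @[n --> \oo] --> `|T s y - y - (s / h) *: (T h x - x)|.
    apply: cvg_norm; apply: cvgB; last exact: cvgZr_tmp.
    apply: cvgB => //; apply: semigroup_cvg => //.
    by apply: nearW => n; rewrite mulr_ge0 // divr_ge0 // ltW.
  have rhs : (p n)%:R / (2 ^ n)%:R * ((M + 1) * d) @[n --> \oo] -->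
     s / h * ((M + 1) * d) by exact: cvgMr_tmp.
  apply: (ler_cvg_to lhs rhs); apply: nearW => n.
  have hn : 0 <= h / (2 ^ n)%:R by rewrite divr_ge0 // ltW.
  rewrite /t /u orbit_mean_shift // -scalerBr normrZ ger0_norm ?divr_ge0 //.
  have -> : (2 ^ n)%:R * (h / (2 ^ n)%:R) = h.
    by rewrite mulrCA mulfV ?mulr1 // gt_eqF.
  case: (posnP (p n)) => [->|pn0]; first by rewrite !mul0r.
  apply: ler_wpM2l; first by rewrite divr_ge0.
  set z := orbit_mean _ _ _.
  have zx : `|z - x| <= d.
    apply: orbit_mean_dist => // k kp; apply: sd; rewrite mulr_ge0 //=.
    apply: (@le_trans _ _ ((p n)%:R * (h / (2 ^ n)%:R))).
      by rewrite ler_wpM2r // ler_nat ltnW.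
    rewrite mulrA ler_pdivrMr // -ler_pdivlMr // mulrAC truncn_le //.
    by rewrite mulr_ge0 // divr_ge0 // ltW.
  have -> : T h z - z - (T h x - x) = T h (z - x) - (z - x).
    by rewrite semigroup_additive // ?(ltW h0) // !opprB [x - T h x]addrC
         addrACA [- z + x]addrC.
  rewrite (le_trans (ler_normB _ _)) // mulrDl mul1r lerD //.
  by rewrite (le_trans (MP _ _ _)) ?ler_wpM2l // ltW ?lexx.
suff : (fun s => s^-1 *: (T s y - y)) @ 0^'+ --> h^-1 *: (T h x - x).
  by case/cvg_generator.
apply/cvgrPdist_le => a a0; have M1 : 0 < M + 1 by rewrite ltr_wpDl.
have ha : 0 < h * a / (M + 1) by rewrite divr_gt0 // mulr_gt0.
have [d d0 dP] := orbit_near0 x ha.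
near=> s; have s0 : 0 < s by near: s; exact: nbhs_right_gt.
have sd : s <= d by near: s; exact: nbhs_right_le.
have smallx r : 0 <= r <= s -> `|T r x - x| <= h * a / (M + 1).
  by move=> /andP[r0 rs]; apply: dP; rewrite r0 (le_trans rs).
have := step s _ (ltW s0) smallx; set w := T s y - y.
have -> : (M + 1) * (h * a / (M + 1)) = h * a by rewrite mulrC divfK ?gt_eqF.
rewrite mulrA divfK ?gt_eqF // => sw.
have -> : h^-1 *: (T h x - x) = s^-1 *: ((s / h) *: (T h x - x)).
  by rewrite scalerA mulKf // gt_eqF.
rewrite distrC -scalerBr normrZ ger0_norm ?invr_ge0 ?(ltW s0) //.
by rewrite ler_pdivrMl.
Unshelve. all: by end_near. Qed.

End Generator.

(** * Bounded perturbations and product schemes *)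

Section Perturbation.
Variables (R : realType) (V : completeNormedModType R) (T0 TC : R -> V -> V).
Variable C : {linear V -> V}.
Hypotheses (T0_semigroup : C0_semigroup T0) (TC_semigroup : C0_semigroup TC).
Hypothesis C_cont : continuous C.
Hypothesis TC_gen : forall x, dom (generator TC) x ->
  dom (generator T0) x /\ generator TC x = generator T0 x + C x.

Lemma operator_norm_bound : exists2 c, 0 <= c & forall x, `|C x| <= c * `|x|.
Proof.
by apply: continuous_linear_norm_bound => // a x y; rewrite linearP.
Qed.

Lemma difference_cvg_dom x : dom (generator TC) x ->
  h^-1 *: (TC h x - T0 h x) @[h --> 0^'+] --> C x.
Proof.
move=> Dx; have [D0x gE] := TC_gen Dx.
have -> : C x = generator TC x - generator T0 x by rewrite gE addrC addKr.
have -> : (fun h => h^-1 *: (TC h x - T0 h x)) =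
    (fun h => h^-1 *: (TC h x - x) - h^-1 *: (T0 h x - x)).
  by apply/funext => h; rewrite -scalerBr opprB addrA subrK.
by apply: cvgB; exact: generator_cvg.
Qed.

(** The path s |-> T0(h - s) TC(s) y joins T0(h) y to TC(h) y.  For y in the
    domain it has right derivative T0(h - s) C TC(s) y, whose norm is at most
    k |y|.  Density of the domain removes the restriction on y. *)
Lemma difference_bound (b : R) :
  exists2 k, 0 <= k & forall h x, 0 <= h <= b -> `|TC h x - T0 h x| <= k * h * `|x|.
Proof.
have [M M0 MP] := semigroup_bounded b T0_semigroup.
have [N N0 NP] := semigroup_bounded b TC_semigroup.
have [c c0 cP] := operator_norm_bound.
(* The product of the bounds of T0, C and TC on the path. *)
pose k := M * c * N; have k0 : 0 <= k by rewrite !mulr_ge0.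
exists k => // h x /andP[h0 hb].
have on_dom y : dom (generator TC) y -> `|TC h y - T0 h y| <= k * h * `|y|.
  move=> Dy; pose u s := T0 (h - s) (TC s y).
  have -> : TC h y - T0 h y = u h - u 0.
    case: T0_semigroup TC_semigroup => _ id0 _ _ [_ idC _ _].
    by rewrite /u subrr subr0 id0 idC.
  have -> : k * h * `|y| = k * `|y| * (h - 0) by rewrite subr0 mulrAC.
  apply: right_lipschitz_bound => //.
    apply/subspace_continuousP => s; rewrite /= in_itv /= => /andP[s0 sh].
    have inside : \forall r \near within `[0, h]%classic (nbhs s), 0 <= r <= h.
      have := withinT `[0, h]%classic (nbhs_filter s).
      by apply: filterS => r; rewrite /= in_itv.
    apply: semigroup_cvg => //.
    - by rewrite subr_ge0.
    - by apply: filterS inside => r /andP[_]; rewrite subr_ge0.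
    - by apply: cvgB; [exact: cvg_cst|exact: cvg_within].
    - apply: semigroup_orbit_cvg => //; last exact: cvg_within.
      by apply: filterS inside => r /andP[].
  move=> s /andP[s0 sh] e e0.
  have Dsy : dom (generator TC) (TC s y) by exact: generator_dom_semigroup.
  have lim : T0 (h - s - d) (d^-1 *: (TC d (TC s y) - T0 d (TC s y)))
      @[d --> 0^'+] --> T0 (h - s) (C (TC s y)).
    apply: semigroup_cvg => //; last exact: difference_cvg_dom.
    - by rewrite subr_ge0 ltW.
    - near=> d; rewrite subr_ge0; near: d; apply: nbhs_right_le.
      by rewrite subr_gt0.
    - rewrite -[X in _ --> X]subr0; apply: cvgB; first exact: cvg_cst.
      exact: cvg_at_right_filter cvg_id.
  have hs : 0 <= h - s <= b.
    by rewrite subr_ge0 (ltW sh) /= (le_trans _ hb) // gerBl.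
  have sb : 0 <= s <= b by rewrite s0 (le_trans (ltW sh)).
  have normlim : `|T0 (h - s) (C (TC s y))| < k * `|y| + e.
    apply: (@le_lt_trans _ _ (k * `|y|)); last by rewrite ltrDl.
    rewrite (le_trans (MP _ _ hs)) // /k -!mulrA ler_wpM2l //.
    by rewrite (le_trans (cP _)) // ler_wpM2l // NP.
  near=> d.
  have d0 : 0 < d by near: d; exact: nbhs_right_gt.
  have sdh : 0 <= h - s - d.
    rewrite subr_ge0; near: d; apply: nbhs_right_le; by rewrite subr_gt0.
  have quot : `|T0 (h - s - d) (d^-1 *: (TC d (TC s y) - T0 d (TC s y)))|
      <= k * `|y| + e by near: d; exact: cvgr_norm_le lim _ normlim.
  have -> : u (s + d) - u s =
      T0 (h - s - d) (TC d (TC s y) - T0 d (TC s y)).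
    rewrite semigroup_additive // /u opprD addrA; congr (_ - _).
      by case: TC_semigroup => _ _ addC _; rewrite [s + d]addrC addC // ltW.
    case: T0_semigroup => _ _ add0 _; rewrite -add0 ?(ltW d0) //.
    by rewrite subrK.
  move: quot; rewrite semigroup_scale // normrZ normfV (gtr0_norm d0).
  by rewrite ler_pdivrMl // [d * _]mulrC.
apply/ler_addgt0Pr => e e0.
have K0 : 0 < k * h + (N + M) + 1.
  by rewrite ltr_wpDl // addr_ge0 ?addr_ge0 ?mulr_ge0.
have [y Dy yx] := generator_dense TC_semigroup x (divr_gt0 e0 K0).
have hb' : 0 <= h <= b by rewrite h0.
have -> : TC h x - T0 h x =
    (TC h y - T0 h y) + (TC h (x - y) - T0 h (x - y)).
  rewrite !semigroup_additive // opprB addrACA [TC h y + _]addrC subrK.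
  by rewrite [- T0 h y + _]addrC addrAC subrr add0r.
set e' := e / _ in yx.
have e'0 : 0 <= e' by rewrite divr_ge0 // ltW.
have h1 : `|TC h y - T0 h y| <= k * h * `|x| + k * h * e'.
  rewrite (le_trans (on_dom y Dy)) // -mulrDr ler_wpM2l ?mulr_ge0 //.
  by rewrite -[y](subrK x) addrC (le_trans (ler_normD _ _)) // lerD2l.
have h2 : `|TC h (x - y) - T0 h (x - y)| <= (N + M) * e'.
  rewrite (le_trans (ler_normB _ _)) // (le_trans (lerD (NP _ _ hb') (MP _ _ hb'))) //.
  by rewrite -mulrDl ler_wpM2l ?addr_ge0 // distrC.
rewrite (le_trans (ler_normD _ _)) // (le_trans (lerD h1 h2)) // -addrA lerD2l.
rewrite -mulrDl /e' mulrCA ler_piMr ?(ltW e0) // ler_pdivrMr // mul1r.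
by rewrite lerDl.
Unshelve. all: by end_near. Qed.

(** The difference quotients are equi-Lipschitz and converge on a dense set. *)
Lemma difference_cvg (I : Type) (F : set_system I) {FF : Filter F}
    (h : I -> R) (x : I -> V) (x0 : V) :
  h @ F --> 0^'+ -> x @ F --> x0 ->
  (h i)^-1 *: (TC (h i) (x i) - T0 (h i) (x i)) @[i --> F] --> C x0.
Proof.
have [k k0 kP] := difference_bound 1.
have [c c0 cP] := operator_norm_bound.
have lip : \forall h \near 0^'+, forall y z,
    `|h^-1 *: (TC h y - T0 h y) - h^-1 *: (TC h z - T0 h z)| <= k * `|y - z|.
  near=> d => y z.
  have d0 : 0 < d by near: d; exact: nbhs_right_gt.
  have d1 : d <= 1 by near: d; exact: nbhs_right_le.
  have -> : d^-1 *: (TC d y - T0 d y) - d^-1 *: (TC d z - T0 d z) =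
      d^-1 *: (TC d (y - z) - T0 d (y - z)).
    rewrite -scalerBr (semigroup_additive TC_semigroup) ?(ltW d0) //.
    rewrite (semigroup_additive T0_semigroup) ?(ltW d0) //; congr (_ *: _).
    by rewrite !opprB [T0 d z - TC d z]addrC [T0 d z - _]addrC addrACA.
  rewrite normrZ ger0_norm ?invr_ge0 ?(ltW d0) // ler_pdivrMl //.
  by rewrite mulrA [d * k]mulrC kP // (ltW d0).
have pointwise y : h^-1 *: (TC h y - T0 h y) @[h --> 0^'+] --> C y.
  apply/cvgrPdist_le => e e0.
  have K0 : 0 < k + c + 1 by rewrite ltr_wpDl // addr_ge0.
  have e20 : 0 < e / 2 by rewrite divr_gt0.
  have [z Dz zy] := generator_dense TC_semigroup y (divr_gt0 e20 K0).
  near=> d.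
  have lipz : forall u v, `|d^-1 *: (TC d u - T0 d u) - d^-1 *: (TC d v - T0 d v)|
      <= k * `|u - v| by near: d.
  have Cz : `|C z - d^-1 *: (TC d z - T0 d z)| <= e / 2.
    by near: d; apply: cvgr_dist_le e20; exact: difference_cvg_dom.
  have lipd := lipz z y; set a := d^-1 *: _ in lipd Cz.
  set a' := d^-1 *: _ in lipd *.
  have -> : C y - a' = (C (y - z) + (a - a')) + (C z - a).
    rewrite linearB -[RHS]addrA [a - a' + _]addrC [C z - a + _]addrA subrK.
    by rewrite addrA subrK.
  rewrite [leRHS]splitr (le_trans (ler_normD _ _)) // lerD //.
  rewrite (le_trans (ler_normD _ _)) // (le_trans (lerD (cP _) lipd)) //.
  rewrite [ `|y - z|]distrC -mulrDl (le_trans (ler_wpM2l _ zy)) ?addr_ge0 //.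
  rewrite mulrCA ler_piMr ?(ltW e20) // ler_pdivrMr // mul1r addrC lerDl.
  by rewrite ler01.
move=> h0 xx0.
apply: (cvg_equilipschitz (B := fun i v => (h i)^-1 *: (TC (h i) v - T0 (h i) v))
         k0 _ _ xx0); first exact: (h0 _ lip).
exact: (@cvg_comp _ _ _ h (fun d => d^-1 *: (TC d x0 - T0 d x0)) F _ _
  h0 (pointwise x0)).
Unshelve. all: by end_near. Qed.

Section Scheme.
(** The correction term of a scheme, left abstract so that one convergence proof
    serves the three product formulas. *)
Variable Q : R -> V -> V.
Hypothesis Q_additive : forall h, 0 <= h -> {morph Q h : x y / x - y}.
Hypothesis Q_bound : forall b, exists2 c, 0 <= c &
  forall h x, 0 <= h <= b -> `|Q h x| <= c * `|x|.
Hypothesis Q_cvg : forall (I : Type) (F : set_system I) (FF : Filter F)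
    (h : I -> R) (x : I -> V) (x0 : V),
  h @ F --> 0^'+ -> x @ F --> x0 -> Q (h i) (x i) @[i --> F] --> C x0.

Definition scheme (h : R) (x : V) := T0 h x + h *: Q h x.

Lemma schemeB h : 0 <= h -> {morph scheme h : x y / x - y}.
Proof.
move=> h0 x y; rewrite /scheme Q_additive // (semigroup_additive T0_semigroup) //.
by rewrite scalerBr opprD addrACA.
Qed.

Lemma iter_schemeB n h : 0 <= h -> {morph iter n (scheme h) : x y / x - y}.
Proof.
by move=> h0 x y; elim: n => // n IHn; rewrite !iterS IHn schemeB.
Qed.

Section Horizon.
Variables (b M c : R).
Hypotheses (M0 : 0 <= M) (c0 : 0 <= c).
Hypothesis T0_bound : forall s x, 0 <= s <= b -> `|T0 s x| <= M * `|x|.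
Hypothesis Q_bound_b : forall h x, 0 <= h <= b -> `|Q h x| <= c * `|x|.

(** The prefix T0(s) strengthens the induction: T0(s) W(h) splits into
    T0(s + h), to which the induction hypothesis applies, and h T0(s) Q(h). *)
Lemma scheme_stable h k s x : 0 <= h <= b -> 0 <= s -> s + k%:R * h <= b ->
  `|T0 s (iter k (scheme h) x)| <= M * (1 + h * (M * c)) ^+ k * `|x|.
Proof.
move=> /andP[h0 hb]; have g0 : 0 <= h * (M * c) by rewrite !mulr_ge0.
have T0_id z : T0 0 z = z by case: T0_semigroup.
elim: k s x => [|k IHk] s x s0 sb.
  by rewrite expr0 mulr1 /= T0_bound // s0; rewrite mul0r addr0 in sb.
have sh : s + h <= b.
  apply: le_trans sb; rewrite lerD2l -natr1 mulrDl mul1r lerDr.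
  by rewrite mulr_ge0.
have sb0 : 0 <= s <= b by rewrite s0 (le_trans _ sh) // lerDl.
rewrite iterS {1}/scheme (semigroup_add T0_semigroup) //.
rewrite (semigroup_scale T0_semigroup) //.
have -> : T0 s (T0 h (iter k (scheme h) x)) = T0 (s + h) (iter k (scheme h) x).
  by case: T0_semigroup => _ _ -> .
have shk : s + h + k%:R * h <= b.
  by move: sb; rewrite -natr1 mulrDl mul1r [_ + h]addrC addrA.
have kh : 0 + k%:R * h <= b.
  by rewrite add0r (le_trans _ shk) // lerDr addr_ge0.
have IH0 := IHk 0 x (lexx 0) kh; rewrite T0_id in IH0.
rewrite (le_trans (ler_normD _ _)) //.
have h1 := IHk (s + h) x (addr_ge0 s0 h0) shk.
set w := iter k _ x in IH0 h1 *; set a := (1 + _) ^+ k in IH0 h1.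
have h2 : `|h *: T0 s (Q h w)| <= h * (M * (c * (M * a * `|x|))).
  rewrite normrZ ger0_norm // ler_wpM2l // (le_trans (T0_bound _ sb0)) //.
  by rewrite ler_wpM2l // (le_trans (Q_bound_b _ _)) ?h0 // ler_wpM2l.
rewrite (le_trans (lerD h1 h2)) // exprS -/a le_eqVlt; apply/orP; left.
by apply/eqP; ring.
Qed.

(** The telescoping sum of W(h)^n - TC(h)^n, run as an induction in which the
    error after k steps is still followed by m steps of the scheme. *)
Lemma scheme_error h q n z : 0 <= h <= b -> n%:R * h <= b -> 0 <= q ->
  (forall k, (k < n)%N ->
    `|scheme h (TC (k%:R * h) z) - TC h (TC (k%:R * h) z)| <= q) ->
  `|iter n (scheme h) z - TC (n%:R * h) z| <=
    n%:R * (M * (1 + h * (M * c)) ^+ n * q).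
Proof.
move=> hb nhb q0 local; have /andP[h0 _] := hb.
have g1 : 1 <= 1 + h * (M * c) by rewrite lerDl !mulr_ge0.
have T0_id y : T0 0 y = y by case: T0_semigroup.
have stable m y : (m <= n)%N ->
    `|iter m (scheme h) y| <= M * (1 + h * (M * c)) ^+ n * `|y|.
  move=> mn; have mhb : 0 + m%:R * h <= b.
    by rewrite add0r (le_trans _ nhb) // ler_wpM2r // ler_nat.
  have := scheme_stable y hb (lexx 0) mhb; rewrite T0_id => /le_trans; apply.
  by rewrite ler_wpM2r // ler_wpM2l // ler_weXn2l.
suff H k m : (k + m <= n)%N ->
    `|iter m (scheme h) (iter k (scheme h) z - TC (k%:R * h) z)| <=
    k%:R * (M * (1 + h * (M * c)) ^+ n * q).
  by apply: (H n 0); rewrite addn0.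
elim: k m => [|k IHk] m kmn.
  have TC_id y : TC 0 y = y by case: TC_semigroup.
  rewrite mul0r TC_id subrr mul0r.
  by have := iter_schemeB m h0 0 0; rewrite !subrr => ->; rewrite normr0.
have -> : iter k.+1 (scheme h) z - TC (k.+1%:R * h) z =
    scheme h (iter k (scheme h) z - TC (k%:R * h) z) -
    (TC h (TC (k%:R * h) z) - scheme h (TC (k%:R * h) z)).
  rewrite schemeB // opprB addrA subrK iterS; congr (_ - _).
  case: TC_semigroup => _ _ addC _; rewrite -addC ?mulr_ge0 //.
  by rewrite -natr1 mulrDl mul1r addrC.
rewrite iter_schemeB // (le_trans (ler_normB _ _)) //.
rewrite -natr1 mulrDl mul1r lerD //.
  by rewrite -iterSr IHk // addnS.
rewrite (le_trans (stable _ _ _)) //; first exact: leq_trans (leq_addl _ _) kmn.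
rewrite ler_wpM2l ?mulr_ge0 ?exprn_ge0 // ?(le_trans _ g1) //.
by rewrite distrC local // (leq_trans _ kmn) // ltnS leq_addr.
Qed.
End Horizon.

(** Uniformity over the orbit segment: the defect is small for (s, n) near each
    (s0, oo) by joint convergence, and [0, t] is compact. *)
Lemma scheme_consistent t z e : 0 < t -> 0 < e ->
  \forall n \near \oo, forall s, 0 <= s <= t ->
    `|scheme (t / n%:R) (TC s z) - TC (t / n%:R) (TC s z)| <= t / n%:R * e.
Proof.
move=> t0 e0; pose h n : R := t / n%:R.
pose P n s := `|scheme (h n) (TC s z) - TC (h n) (TC s z)| <= h n * e.
have /compact_near_coveringP/near_covering_withinP cover := @segment_compact R 0 t.
suff : \forall n \near \oo, `[0, t]%classic `<=` P n.
  by apply: filterS => n H s st; apply: H; rewrite /= in_itv.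
apply: cover => s0 /=; rewrite in_itv /= => /andP[s00 s0t].
pose G := filter_prod (within `[0, t]%classic (nbhs s0)) (\oo : set_system nat).
have FG : Filter G by exact: filter_prod_filter.
have hG : (fun p => h p.2) @ G --> (0 : R)^'+.
  apply: (@cvg_comp _ _ _ snd h G _ _ _ (div_nat_cvg_right t0)).
  exact: cvg_snd.
have G_within : filter_prod (within `[0, t]%classic (nbhs s0)) (\oo : set_system nat)
    [set p | 0 <= p.1 <= t].
  exists ([set s | 0 <= s <= t], setT); last by move=> [s n] [].
  split => /=; last exact: filterT.
  have := withinT `[0, t]%classic (nbhs_filter s0).
  by apply: filterS => r; rewrite /= in_itv.
have orbit : (fun p => TC p.1 z) @ G --> TC s0 z.
  apply: semigroup_orbit_cvg => //; first by apply: filterS G_within => p /andP[].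
  by apply: cvg_trans (cvg_within _); exact: cvg_fst.
have defect : (h p.2)^-1 *: (TC (h p.2) (TC p.1 z) - T0 (h p.2) (TC p.1 z)) -
    Q (h p.2) (TC p.1 z) @[p --> G] --> C (TC s0 z) - C (TC s0 z).
  by apply: cvgB; [exact: difference_cvg|exact: Q_cvg].
have hpos : \forall p \near G, 0 < h p.2 by exact: hG _ (nbhs_right_gt 0).
have small : `|C (TC s0 z) - C (TC s0 z)| < e by rewrite subrr normr0.
have [[A B] /= [wA FB] AB] : \forall p \near G, P p.2 p.1.
  move: hpos (@cvgr_norm_le _ _ _ _ FG _ _ defect _ small).
  apply: filterS2 => p; rewrite /P.
  set d := h p.2; set y := TC p.1 z => d0 dq.
  have -> : scheme d y - TC d y = - (d *: (d^-1 *: (TC d y - T0 d y) - Q d y)).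
    rewrite scalerBr scalerA mulfV ?gt_eqF // scale1r /scheme !opprB.
    by rewrite addrA [d *: _ + _]addrC.
  by rewrite normrN normrZ gtr0_norm // ler_wpM2l // ltW.
exists ([set s | `[0, t]%classic s -> A s], B); first by split.
by move=> [s n] /= [sA Bn] st; apply: (AB (s, n)); split => //=; exact: sA.
Qed.

Theorem scheme_cvg t z : 0 <= t ->
  iter n (scheme (t / n%:R)) z @[n --> \oo] --> TC t z.
Proof.
rewrite le_eqVlt => /predU1P[<-|t0].
  have -> : (fun n => iter n (scheme (0 / n%:R)) z) = fun=> TC 0 z.
    apply/funext => n; case: T0_semigroup TC_semigroup => _ id0 _ _ [_ idC _ _].
    rewrite mul0r idC; elim: n => //= n ->.
    by rewrite /scheme id0 scale0r addr0.
  exact: cvg_cst.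
have [M M0 MP] := semigroup_bounded t T0_semigroup.
have [c c0 cP] := Q_bound t.
(* Bounds n h M (1 + hMc)^n for h = t / n. *)
pose B := t * (M * expR (t * (M * c))).
have B0 : 0 <= B by rewrite !mulr_ge0 ?expR_ge0 // ltW.
apply/cvgrPdist_le => e e0.
have e'0 : 0 < e / (B + 1) by rewrite divr_gt0 // ltr_wpDl.
have consistent := scheme_consistent z t0 e'0.
near=> n.
have n0 : 0 < n%:R :> R by near: n; exact: nbhs_infty_gtr.
have nt : n%:R * (t / n%:R) = t by rewrite mulrC divfK // gt_eqF.
have h0 : 0 <= t / n%:R by rewrite divr_ge0 // ltW.
have ht : t / n%:R <= t.
  by rewrite ler_pdivrMr // ler_peMr ?(ltW t0) // ler1n -(ltr0n R).
have cons : forall s, 0 <= s <= t ->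
    `|scheme (t / n%:R) (TC s z) - TC (t / n%:R) (TC s z)| <=
    t / n%:R * (e / (B + 1)) by near: n.
have error : `|TC t z - iter n (scheme (t / n%:R)) z| <=
    n%:R * (M * (1 + t / n%:R * (M * c)) ^+ n * (t / n%:R * (e / (B + 1)))).
  have := @scheme_error t M c M0 c0 MP cP (t / n%:R) (t / n%:R * (e / (B + 1))) n z.
  rewrite h0 ht nt distrC; apply => //; first by rewrite mulr_ge0 // ltW.
  move=> k kn; apply: cons; rewrite mulr_ge0 //= -[leRHS]nt.
  by rewrite ler_wpM2r // ler_nat ltnW.
apply: le_trans error _.
have -> : n%:R * (M * (1 + t / n%:R * (M * c)) ^+ n * (t / n%:R * (e / (B + 1)))) =
    t * (M * (1 + t / n%:R * (M * c)) ^+ n) * (e / (B + 1)).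
  set a := _ ^+ n; set q := e / _; rewrite -[in RHS]nt; set h := t / _.
  by ring.
have growth : (1 + t / n%:R * (M * c)) ^+ n <= expR (t * (M * c)).
  have -> : t * (M * c) = n%:R * (t / n%:R * (M * c)) by rewrite mulrA nt.
  rewrite expRM_natl lerXn2r ?nnegrE ?expR_ge0 ?expR_ge1Dx //.
  by rewrite addr_ge0 // mulr_ge0 // mulr_ge0.
apply: (@le_trans _ _ (B * (e / (B + 1)))).
  by rewrite ler_wpM2r ?(ltW e'0) // ler_wpM2l ?(ltW t0) // ler_wpM2l.
rewrite mulrCA ler_piMr ?(ltW e0) // ler_pdivrMr ?mul1r ?lerDl //.
by rewrite ltr_wpDl.
Unshelve. all: by end_near. Qed.
End Scheme.

Lemma cvg_at_right0 (I : Type) (F : set_system I) (h : I -> R) :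
  h @ F --> (0 : R)^'+ -> h @ F --> (0 : R).
Proof. by move=> h0; apply: cvg_trans h0 _; exact: cvg_within. Qed.

Lemma near_at_right_ge0 (I : Type) (F : set_system I) {FF : Filter F} (h : I -> R) :
  h @ F --> (0 : R)^'+ -> \forall i \near F, 0 <= h i.
Proof. by move=> h0; exact: (h0 _ (nbhs_right_ge 0)). Qed.

Lemma semigroup_cvg_id (I : Type) (F : set_system I) {FF : Filter F}
    (h : I -> R) (x : I -> V) (x0 : V) :
  h @ F --> (0 : R)^'+ -> x @ F --> x0 -> T0 (h i) (x i) @[i --> F] --> x0.
Proof.
move=> h0 xx0; have -> : x0 = T0 0 x0 by case: T0_semigroup => _ ->.
apply: semigroup_cvg => //; first exact: near_at_right_ge0.
exact: cvg_at_right0.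
Qed.

(** In the three formulas below w + h C w stands for the exponential of hC. *)
Theorem lie_product_cvg t z : 0 <= t ->
  iter n (fun w => T0 (t / n%:R) w + (t / n%:R) *: C (T0 (t / n%:R) w)) z
    @[n --> \oo] --> TC t z.
Proof.
have [c c0 cP] := operator_norm_bound.
apply: (@scheme_cvg (fun h x => C (T0 h x))).
- by move=> h h0 x y; rewrite (semigroup_additive T0_semigroup) // linearB.
- move=> b; have [M M0 MP] := semigroup_bounded b T0_semigroup.
  exists (c * M); first exact: mulr_ge0.
  by move=> h x hb; rewrite (le_trans (cP _)) // -mulrA ler_wpM2l // MP.
- move=> I F FF h x x0 h0 xx0; apply: continuous_cvg; first exact: C_cont.
  exact: semigroup_cvg_id.
Qed.

Theorem strang_product_cvg t z : 0 <= t ->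
  iter n (fun w => let v := T0 (t / (2 * n%:R)) w in
    T0 (t / (2 * n%:R)) (v + (t / n%:R) *: C v)) z @[n --> \oo] --> TC t z.
Proof.
move=> t0; have [c c0 cP] := operator_norm_bound.
have half_ge0 (h : R) : 0 <= h -> 0 <= h / 2 by move=> h0; rewrite divr_ge0.
have half_le (h b : R) : 0 <= h <= b -> 0 <= h / 2 <= b.
  move=> /andP[h0 hb]; rewrite half_ge0 //= (le_trans _ hb) //.
  by rewrite ler_pdivrMr // ler_peMr // ler1n.
have half_right : (fun h => h / 2) @ (0 : R)^'+ --> (0 : R)^'+.
  move=> A /nbhs_ballP[d /= d0 dA].
  change (\forall h \near (0 : R)^'+, A (h / 2)); near=> h.
  have h0 : 0 < h by near: h; exact: nbhs_right_gt.
  have h20 : 0 < h / 2 by rewrite divr_gt0.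
  apply: dA => //; rewrite /ball /= sub0r normrN gtr0_norm //.
  apply: (@le_lt_trans _ _ h); first by rewrite ler_pdivrMr // ler_peMr ?(ltW h0) ?ler1n.
  by near: h; exact: nbhs_right_lt.
set u := fun n : nat => _.
have -> : u = (fun n => iter n (scheme (fun h x => T0 (h / 2) (C (T0 (h / 2) x)))
    (t / n%:R)) z).
  apply/funext => n; apply: eq_iter => w; rewrite /scheme.
  have -> : t / (2 * n%:R) = t / n%:R / 2 by rewrite invfM mulrCA mulrC.
  have h0 : 0 <= t / n%:R by rewrite divr_ge0.
  set h := t / n%:R in h0 *.
  rewrite (semigroup_add T0_semigroup) ?half_ge0 //.
  rewrite (semigroup_scale T0_semigroup) ?half_ge0 //; congr (_ + _).
  by case: T0_semigroup => _ _ add0 _; rewrite -add0 ?half_ge0 // -splitr.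
apply: scheme_cvg t0.
- move=> h h0 x y; rewrite (semigroup_additive T0_semigroup) ?half_ge0 //.
  by rewrite linearB (semigroup_additive T0_semigroup) ?half_ge0.
- move=> b; have [M M0 MP] := semigroup_bounded b T0_semigroup.
  exists (M * (c * M)); first by rewrite !mulr_ge0.
  move=> h x /half_le hb; rewrite (le_trans (MP _ _ hb)) // -!mulrA ler_wpM2l //.
  by rewrite (le_trans (cP _)) // ler_wpM2l // MP.
- move=> I F FF h x x0 h0 xx0.
  have h20 : (fun i => h i / 2) @ F --> (0 : R)^'+.
    exact: (@cvg_comp _ _ _ h (fun h => h / 2) F _ _ h0 half_right).
  apply: semigroup_cvg_id (h20) _; apply: continuous_cvg; first exact: C_cont.
  exact: semigroup_cvg_id (h20) xx0.
Unshelve. all: by end_near. Qed.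

Theorem weighted_product_cvg t z : 0 <= t ->
  (2 ^+ n)^-1 *: iter n (fun w =>
     T0 (t / n%:R) (w + (t / n%:R) *: C w) +
     (T0 (t / n%:R) w + (t / n%:R) *: C (T0 (t / n%:R) w))) z
  @[n --> \oo] --> TC t z.
Proof.
move=> t0; have [c c0 cP] := operator_norm_bound.
pose Q h x := 2^-1 *: (T0 h (C x) + C (T0 h x)).
set u := fun n : nat => _.
have -> : u = (fun n => iter n (scheme Q (t / n%:R)) z).
  apply/funext => n; rewrite /u.
  have h0 : 0 <= t / n%:R by rewrite divr_ge0.
  set h := t / n%:R in h0 *.
  have double w : T0 h (w + h *: C w) + (T0 h w + h *: C (T0 h w)) =
      2 *: scheme Q h w.
    rewrite (semigroup_add T0_semigroup) // (semigroup_scale T0_semigroup) //.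
    rewrite /scheme /Q addrACA -scalerDr -mulr2n [RHS]scalerDr.
    by rewrite [2 *: T0 h w]scaler_nat !scalerA mulrAC mulfV ?mul1r.
  have homogeneous a w : scheme Q h (a *: w) = a *: scheme Q h w.
    rewrite /scheme /Q [C (a *: w)]linearZ /= !(semigroup_scale T0_semigroup) //.
    rewrite [C (a *: _)]linearZ /= -[a *: _ + a *: _]scalerDr [RHS]scalerDr.
    by rewrite !scalerA [_ * a]mulrC mulrA.
  have -> m : iter m (fun w => T0 h (w + h *: C w) + (T0 h w + h *: C (T0 h w))) z =
      2 ^+ m *: iter m (scheme Q h) z.
    elim: m => [|m IHm]; first by rewrite expr0 scale1r.
    by rewrite iterS IHm double homogeneous scalerA -exprS.
  by rewrite scalerA mulVf ?scale1r // expf_neq0 // pnatr_eq0.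
apply: scheme_cvg t0; rewrite /Q.
- move=> h h0 x y; rewrite linearB !(semigroup_additive T0_semigroup) // linearB.
  by rewrite -scalerBr opprD addrACA.
- move=> b; have [M M0 MP] := semigroup_bounded b T0_semigroup.
  exists (c * M) => [|h x hb]; first exact: mulr_ge0.
  rewrite normrZ ger0_norm ?invr_ge0 // ler_pdivrMl // (le_trans (ler_normD _ _)) //.
  rewrite mulr_natl mulr2n lerD //.
    by rewrite (le_trans (MP _ _ hb)) // [c * M]mulrC -mulrA ler_wpM2l.
  by rewrite (le_trans (cP _)) // -mulrA ler_wpM2l // MP.
- move=> I F FF h x x0 h0 xx0.
  have -> : C x0 = 2^-1 *: (C x0 + C x0).
    by rewrite -mulr2n -[C x0 *+ 2]scaler_nat scalerA mulVf ?scale1r // pnatr_eq0.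
  apply: cvgZl_tmp; apply: cvgD.
    by apply: semigroup_cvg_id h0 _; apply: continuous_cvg => //; exact: C_cont.
  by apply: continuous_cvg; [exact: C_cont|exact: semigroup_cvg_id].
Qed.
End Perturbation.

(** * Completeness of a product *)

Section ProductComplete.
Variables (K : numFieldType) (E F : completeNormedModType K).

Lemma prod_cauchy_cvg (G : set_system (E * F : normedModType K)) :
  ProperFilter G -> cauchy G -> cvg G.
Proof.
move=> PG /cauchy_ballP cG.
have c1 : cauchy (fst @ G).
  apply/cauchy_ballP => e e0; have := cG e e0.
  move=> [[X Y] /= [GX GY] XY].
  exists (fst @` X, fst @` Y).
    by split; [apply: filterS GX|apply: filterS GY]; move=> p ?; exists p.
  by move=> [_ _] [/= [p Xp <-] [q Yq <-]]; have [] := XY (p, q) (conj Xp Yq).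
have c2 : cauchy (snd @ G).
  apply/cauchy_ballP => e e0; have := cG e e0.
  move=> [[X Y] /= [GX GY] XY].
  exists (snd @` X, snd @` Y).
    by split; [apply: filterS GX|apply: filterS GY]; move=> p ?; exists p.
  by move=> [_ _] [/= [p Xp <-] [q Yq <-]]; have [] := XY (p, q) (conj Xp Yq).
have /cvg_ex[p Gp] : cvg (fst @ G) by exact: cauchy_cvg.
have /cvg_ex[q Gq] : cvg (snd @ G) by exact: cauchy_cvg.
apply/cvg_ex; exists (p, q).
have : (fun x => (x.1, x.2)) @ G --> (p, q) by exact: cvg_pair.
by rewrite (_ : (fun x => (x.1, x.2)) = id) //; apply/funext => -[].
Qed.

HB.instance Definition _ := Uniform_isComplete.Build (E * F)%type prod_cauchy_cvg.

End ProductComplete.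

(** * Restriction of scalars to the reals *)

(** What the inclusions of the reals in the two scalar fields have in common:
    times and norms, being nonnegative, can be pulled back to the reals. *)
Record real_embedding (R : realType) (K : numFieldType) := RealEmbedding {
  emb :> {rmorphism R -> K};
  emb_le : {mono emb : x y / x <= y};
  emb_onto : forall t : K, 0 <= t -> exists r, t = emb r }.

(** An alias of V that carries the structure of a normed space over R.  It keeps
    the uniform structure of V, so limits in both spaces are the same
    propositions. *)
Definition restrict_scalars (R : realType) (K : numFieldType)
  (i : real_embedding R K) (V : Type) : Type := V.

Section RestrictScalars.
Variables (R : realType) (K : numFieldType) (i : real_embedding R K).
Variable (V : completeNormedModType K).
Local Notation W := (restrict_scalars i V).

HB.instance Definition _ := GRing.Zmodule.copy W V.
HB.instance Definition _ := Complete.copy W V.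

Definition restrict_scale (a : R) (v : W) : W := i a *: (v : V).

Lemma restrict_scaleA a b v :
  restrict_scale a (restrict_scale b v) = restrict_scale (a * b) v.
Proof. by rewrite /restrict_scale scalerA rmorphM. Qed.

Lemma restrict_scale1 : left_id 1 restrict_scale.
Proof. by move=> v; rewrite /restrict_scale rmorph1 scale1r. Qed.

Lemma restrict_scaleDr : right_distributive restrict_scale +%R.
Proof. by move=> a u v; rewrite /restrict_scale scalerDr. Qed.

Lemma restrict_scaleDl v : {morph restrict_scale^~ v : a b / a + b}.
Proof. by move=> a b; rewrite /restrict_scale rmorphD scalerDl. Qed.

HB.instance Definition _ := GRing.Zmodule_isLmodule.Build R W
  restrict_scaleA restrict_scale1 restrict_scaleDr restrict_scaleDl.

(** The norm of V takes its values in K but these are nonnegative, hence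
    images of reals. *)
Definition restrict_norm (v : W) : R := sval (cid (emb_onto i (normr_ge0 (v : V)))).

Lemma emb_norm v : i (restrict_norm v) = `|v : V|.
Proof. by rewrite /restrict_norm; case: cid. Qed.

Lemma emb_lt : {mono i : x y / x < y}.
Proof. exact: leW_mono (emb_le i). Qed.

Lemma emb_inj : injective i.
Proof. exact: fmorph_inj. Qed.

Lemma emb_ge0 (a : R) : (0 <= i a) = (0 <= a).
Proof. by rewrite -[in LHS](rmorph0 i) emb_le. Qed.

Lemma emb_gt0 (a : R) : (0 < i a) = (0 < a).
Proof. by rewrite -[in LHS](rmorph0 i) emb_lt. Qed.

Lemma emb_normr (a : R) : `|i a| = i `|a|.
Proof.
have [a0|a0] := leP 0 a; first by rewrite !ger0_norm // emb_ge0.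
have ia : i a < 0 by rewrite -(rmorph0 i) emb_lt.
by rewrite (ltr0_norm a0) (ltr0_norm ia) rmorphN.
Qed.

Lemma restrict_normD u v :
  restrict_norm (u + v) <= restrict_norm u + restrict_norm v.
Proof. by rewrite -(emb_le i) rmorphD !emb_norm ler_normD. Qed.

Lemma restrict_norm_eq0 v : restrict_norm v = 0 -> v = 0.
Proof. by move=> v0; apply/normr0_eq0; rewrite -emb_norm v0 rmorph0. Qed.

Lemma restrict_normMn v n : restrict_norm (v *+ n) = restrict_norm v *+ n.
Proof. by apply: emb_inj; rewrite rmorphMn /= !emb_norm normrMn. Qed.

Lemma restrict_normN v : restrict_norm (- v) = restrict_norm v.
Proof. by apply: emb_inj; rewrite !emb_norm normrN. Qed.

HB.instance Definition _ := Num.Zmodule_isNormed.Build R W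
  restrict_normD restrict_norm_eq0 restrict_normMn restrict_normN.

Definition restrict_ball : W -> R -> set W := ball_ restrict_norm.

Lemma restrict_ballE x e : restrict_ball x e = ball (x : V) (i e).
Proof.
by rewrite -ball_normE; apply/seteqP; split => y /=;
  rewrite /restrict_ball /ball_ /= -emb_norm emb_lt.
Qed.

Lemma restrict_ball_center x e : 0 < e -> restrict_ball x e x.
Proof. by rewrite restrict_ballE -emb_gt0; exact: ballxx. Qed.

Lemma restrict_ball_sym x y e : restrict_ball x e y -> restrict_ball y e x.
Proof. by rewrite !restrict_ballE; exact: ball_sym. Qed.

Lemma restrict_ball_triangle x y z e1 e2 :
  restrict_ball x e1 y -> restrict_ball y e2 z -> restrict_ball x (e1 + e2) z.
Proof. by rewrite !restrict_ballE rmorphD; exact: ball_triangle. Qed.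

Lemma restrict_entourageE :
  entourage = entourage_ restrict_ball :> set_system (W * W).
Proof.
rewrite -[LHS]/(@entourage V) -entourage_ballE.
apply/seteqP; split => A [e /= e0 eA].
  have [r er] := emb_onto i (ltW e0); exists r; first by rewrite /= -emb_gt0 -er.
  by move=> p; rewrite /= restrict_ballE -er; exact: eA.
exists (i e); first by rewrite /= emb_gt0.
by move=> p /= pe; apply: eA; rewrite /= restrict_ballE.
Qed.

HB.instance Definition _ := Uniform_isPseudoMetric.Build R W
  restrict_ball_center restrict_ball_sym restrict_ball_triangle restrict_entourageE.

HB.instance Definition _ := NormedZmod_PseudoMetric_eq.Build R W erefl.

Lemma restrict_normZ (a : R) (v : W) : `|a *: v| = `|a| * `|v|.
Proof.
by apply: emb_inj; rewrite rmorphM /= !emb_norm /GRing.scale /= normrZ emb_normr.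
Qed.

HB.instance Definition _ :=
  PseudoMetricNormedZmod_Lmodule_isNormedModule.Build R W restrict_normZ.

Lemma emb_continuous : continuous (i : R -> K).
Proof.
move=> r; apply/cvgrPdist_lt => e e0.
have [d ed] := emb_onto i (ltW e0).
have d0 : 0 < d by rewrite -emb_gt0 -ed.
near=> s; rewrite -rmorphB emb_normr ed emb_lt.
by near: s; exact: cvgr_dist_lt.
Unshelve. all: by end_near. Qed.

(** One-sided limits at 0 over R and over K are the same, since every positive
    element of K is the image of a positive real. *)
Lemma emb_at_right : i @ (0 : R)^'+ = (0 : K)^'+.
Proof.
apply/seteqP; split => A.
  move=> /nbhs_ballP[d /= d0 dA]; apply/nbhs_ballP; exists (i d) => /=.
    by rewrite emb_gt0.
  move=> y; rewrite /ball /= sub0r normrN => yd y0.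
  have [r yr] := emb_onto i (ltW y0); rewrite yr; apply: dA.
    by rewrite /ball /= sub0r normrN -emb_lt -emb_normr -yr.
  by rewrite -emb_gt0 -yr.
move=> /nbhs_ballP[d /= d0 dA]; apply/nbhs_ballP.
have [r dr] := emb_onto i (ltW d0); exists r => /=; first by rewrite -emb_gt0 -dr.
move=> s; rewrite /ball /= sub0r normrN => sr s0; apply: dA; last by rewrite emb_gt0.
by rewrite /ball /= sub0r normrN emb_normr dr emb_lt.
Qed.

Definition restrict_times (T : K -> V -> V) : R -> W -> W := fun r => T (i r).

Lemma C0_semigroup_restrict (T : K -> V -> V) :
  C0_semigroup T -> C0_semigroup (restrict_times T).
Proof.
case=> Tlin Tid Tadd Tcont; split.
- move=> r r0; have [|Tl Tc] := Tlin (i r); first by rewrite emb_ge0.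
  by split; [move=> a x y; exact: Tl|exact: Tc].
- by move=> x; rewrite /restrict_times rmorph0.
- by move=> s t s0 t0 x; rewrite /restrict_times rmorphD Tadd // emb_ge0.
move=> x; apply/subspace_continuousP => r r0.
have /subspace_continuousP/(_ (i r)) lim := Tcont x.
have ir0 : 0 <= i r by rewrite emb_ge0.
apply: (@cvg_comp _ _ _ i (fun t => T t x) _ _ _ _ (lim ir0)).
move=> A; rewrite /within /= !nbhs_simpl /= => nA.
have : \forall s \near r, 0 <= i s -> A (i s) by exact: (emb_continuous nA).
by apply: filterS => s sA s0; apply: sA; rewrite emb_ge0.
Qed.

Lemma generator_restrict_cvg (T : K -> V -> V) (x l : V) :
  ((fun h => h^-1 *: (restrict_times T h x - (x : W))) @ (0 : R)^'+ --> (l : W)) <->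
  ((fun h => h^-1 *: (T h x - x)) @ (0 : K)^'+ --> l).
Proof.
rewrite -emb_at_right.
have -> : (fun h => h^-1 *: (restrict_times T h x - (x : W))) =
    (fun h => (i h)^-1 *: (T (i h) x - x)) :> (R -> V).
  by apply/funext => h; rewrite -fmorphV.
by [].
Qed.

Lemma generator_restrict_dom (T : K -> V -> V) (x : V) :
  dom (generator (restrict_times T)) x <-> dom (generator T) x.
Proof.
split=> /cvg_ex[l Tl]; apply/cvg_ex; exists l; exact/generator_restrict_cvg.
Qed.

Lemma generator_restrict (T : K -> V -> V) (x : V) :
  dom (generator T) x -> generator (restrict_times T) x = generator T x.
Proof.
move=> Dx; have /generator_restrict_cvg Tx :
  (fun h => h^-1 *: (T h x - x)) @ (0 : K)^'+ --> generator T x by [].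
by have [] := cvg_generator Tx.
Qed.
End RestrictScalars.

(** * The coupled operators *)

(** From the third term on the exponential series vanishes. *)
Lemma exp_op_square_zero (K : numFieldType) (V : normedModType K) (N : V -> V) z :
  (forall w, N (N w) = 0) -> exp_op N z = z + N z.
Proof.
move=> NN; apply: cvg_lim; first exact: norm_hausdorff.
apply: cvg_near_cst; exists 2%N => // -[|[|n]] // _.
rewrite seriesEord /= !big_ord_recl /= big1 => [|k _].
  by rewrite addr0 fact0 invr1 !scale1r.
by rewrite NN scaler0.
Qed.

Lemma expC_eq (K : numFieldType) (E F : normedModType K) (C : {linear E -> F})
    (t : K) (z : E * F) :
  expC C t z = z + t *: (calC C z : E * F).
Proof.
apply: exp_op_square_zero => w; apply/pair_equal_spec.
by split; rewrite /= ?scaler0 // linear0 scaler0.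
Qed.

Lemma calC_linear (K : numFieldType) (E F : normedModType K) (C : {linear E -> F}) :
  linear (calC C : E * F -> E * F).
Proof.
move=> a x y; apply/pair_equal_spec; split => /=; first by rewrite scaler0 addr0.
by rewrite linearP.
Qed.

Lemma calC_continuous (K : numFieldType) (E F : normedModType K) (C : E -> F) :
  continuous C -> continuous (calC C : E * F -> E * F).
Proof.
move=> Cc z; apply: cvg_pair => //=; first exact: cvg_cst.
by apply: continuous_comp; [exact: cvg_fst|exact: Cc].
Qed.

Section Products.
Variables (R : realType) (K : numFieldType) (i : real_embedding R K).
Variables (E F : completeNormedModType K).
Variables (Am : operator E E) (B : operator F F) (L : operator E F).
Variables (C : {linear E -> F}) (C_cont : continuous C).
Variables (T0 TC : K -> E * F -> E * F).
Hypotheses (T0_gen : generates (opA_0 Am B L) T0).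
Hypotheses (TC_gen : generates (opA_C Am B L C) TC).

Local Notation W := (restrict_scalars i (E * F)%type).

Definition restrict_calC : W -> W := calC C.

Lemma restrict_calC_linear : linear restrict_calC.
Proof. by move=> a; exact: (calC_linear C). Qed.

HB.instance Definition _ := GRing.isLinear.Build R W W *:%R restrict_calC
  restrict_calC_linear.

Lemma restrict_calC_continuous : continuous (restrict_calC : W -> W).
Proof. exact: (calC_continuous C_cont). Qed.

Let T0' : R -> W -> W := restrict_times T0.
Let TC' : R -> W -> W := restrict_times TC.

(** Both matrix operators have the same domain and differ by the bounded
    off-diagonal part. *)
Lemma coupled_generator x : dom (generator TC') x ->
  dom (generator T0') x /\ generator TC' x = generator T0' x + restrict_calC x.
Proof.
case: T0_gen TC_gen => [_ [D0 A0E]] [_ [DC ACE]].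
move=> /generator_restrict_dom Dx.
have cx : coupled_dom Am B L x by move: (Dx); rewrite -DC.
have D0x : dom (generator T0) x by rewrite -D0.
have gC : generator TC x = (Am x.1, C x.1 + B x.2) := esym (ACE x cx).
have g0 : generator T0 x = (Am x.1, B x.2) := esym (A0E x cx).
split; first exact/generator_restrict_dom.
apply: (etrans (etrans (generator_restrict i Dx) gC)).
apply: (etrans _ (congr1 (fun y => y + restrict_calC x)
                    (esym (etrans (generator_restrict i D0x) g0)))).
by apply/pair_equal_spec; split; rewrite /= ?addr0 // addrC.
Qed.

(** The real theorems applied to the space with restricted scalars and to the
    preimage in R of the time t; the iterates coincide term by term. *)
Theorem products_cvg z t : 0 <= t ->
    [/\ (fun n : nat =>
           iter n (fun w => expC C (t / n%:R) (T0 (t / n%:R) w)) z)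
          @ \oo --> TC t z,
        (fun n : nat =>
           iter n (fun w => T0 (t / (2 * n%:R))
                              (expC C (t / n%:R) (T0 (t / (2 * n%:R)) w))) z)
          @ \oo --> TC t z
      & (fun n : nat =>
           (2 ^+ n)^-1 *:
             iter n (fun w => T0 (t / n%:R) (expC C (t / n%:R) w)
                              + expC C (t / n%:R) (T0 (t / n%:R) w)) z)
          @ \oo --> TC t z].
Proof.
have T0sg : C0_semigroup T0' by apply: C0_semigroup_restrict; case: T0_gen.
have TCsg : C0_semigroup TC' by apply: C0_semigroup_restrict; case: TC_gen.
move=> t0; have [r tr] := emb_onto i t0; move: t0; rewrite {t}tr emb_ge0 => r0.
have div_n (n : nat) : i r / n%:R = i (r / n%:R) by rewrite fmorph_div rmorph_nat.
have div_2n (n : nat) : i r / (2 * n%:R) = i (r / (2 * n%:R)).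
  by rewrite fmorph_div rmorphM !rmorph_nat.
split.
- have := @lie_product_cvg R W T0' TC' restrict_calC T0sg TCsg
    restrict_calC_continuous coupled_generator r z r0.
  rewrite [X in X @ _](_ : _ = (fun n : nat =>
           iter n (fun w => expC C (i r / n%:R) (T0 (i r / n%:R) w)) z)) //.
  by apply/funext => n; apply: eq_iter => w; rewrite expC_eq div_n.
- have := @strang_product_cvg R W T0' TC' restrict_calC T0sg TCsg
    restrict_calC_continuous coupled_generator r z r0.
  rewrite [X in X @ _](_ : _ = (fun n : nat =>
           iter n (fun w => T0 (i r / (2 * n%:R))
                              (expC C (i r / n%:R) (T0 (i r / (2 * n%:R)) w))) z)) //.
  by apply/funext => n; apply: eq_iter => w; rewrite expC_eq div_n div_2n.
- have := @weighted_product_cvg R W T0' TC' restrict_calC T0sg TCsg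
    restrict_calC_continuous coupled_generator r z r0.
  rewrite [X in X @ _](_ : _ = (fun n : nat =>
           (2 ^+ n)^-1 *:
             iter n (fun w => T0 (i r / n%:R) (expC C (i r / n%:R) w)
                              + expC C (i r / n%:R) (T0 (i r / n%:R) w)) z)) //.
  apply/funext => n; rewrite -[LHS]/(i _ *: _) fmorphV rmorphXn rmorph_nat.
  by congr (_ *: _); apply: eq_iter => w; rewrite !expC_eq div_n.
Qed.
End Products.

Lemma idfun_le (R : realType) : {mono (idfun : {rmorphism R -> R}) : x y / x <= y}.
Proof. by []. Qed.

Lemma idfun_onto (R : realType) (t : R) : 0 <= t ->
  exists r, t = (idfun : {rmorphism R -> R}) r.
Proof. by exists t. Qed.

Definition real_embedding_id (R : realType) : real_embedding R R :=
  RealEmbedding (@idfun_le R) (@idfun_onto R).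

Lemma real_complex_le (R : realType) :
  {mono (real_complex R : {rmorphism R -> R[i]}) : x y / x <= y}.
Proof. by move=> x y; exact: lecR. Qed.

Lemma real_complex_onto (R : realType) (t : R[i]) : 0 <= t ->
  exists r, t = (real_complex R : {rmorphism R -> R[i]}) r.
Proof. by move=> /ger0_real/complex_realP. Qed.

Definition real_embedding_complex (R : realType) : real_embedding R R[i] :=
  RealEmbedding (@real_complex_le R) (@real_complex_onto R).

Theorem corollary3p10 (R : realType) (K : numFieldType)
    (hK : real_or_complex R K) (E F : completeNormedModType K)
    (Am : operator E E) (B : operator F F) (L : operator E F)
    (Am_lin : linear_operator Am) (B_lin : linear_operator B)
    (L_lin : linear_operator L) (L_dom : dom L = dom Am)
    (A_gen : is_generator (op_restrict Am (op_ker L)))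
    (L_surj : set_surj (dom Am) setT L)
    (AmL_closed : closed_operator (op_column Am L))
    (B_gen : is_generator B)
    (C : {linear E -> F}) (C_bounded : continuous C)
    (T0 : K -> E * F -> E * F) (T0_gen : generates (opA_0 Am B L) T0)
    (TC : K -> E * F -> E * F) (TC_gen : generates (opA_C Am B L C) TC) :
  forall (z : E * F) (t : K), 0 <= t ->
    [/\ (fun n : nat =>
           iter n (fun w => expC C (t / n%:R) (T0 (t / n%:R) w)) z)
          @ \oo --> TC t z,
        (fun n : nat =>
           iter n (fun w => T0 (t / (2 * n%:R))
                              (expC C (t / n%:R) (T0 (t / (2 * n%:R)) w))) z)
          @ \oo --> TC t z
      & (fun n : nat =>
           (2 ^+ n)^-1 *:
             iter n (fun w => T0 (t / n%:R) (expC C (t / n%:R) w)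
                              + expC C (t / n%:R) (T0 (t / n%:R) w)) z)
          @ \oo --> TC t z].
Proof.
move=> z t t0.
have [incl] : inhabited (real_embedding R K).
  by case: hK => ->; constructor; [exact: real_embedding_id|exact: real_embedding_complex].
exact (products_cvg incl C_bounded T0_gen TC_gen z t0).
Qed.
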